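(* Let $\phi_1$ and $\phi_2$ be two non-pathological lsc submeasures on $\mathbb{N}$ and assume that $\phi_1(\{i\})>0$ and $\phi_2(\{i\})>0$ for every $i\in\mathbb{N}$. The following are equivalent: (a) $\phi_2\preceq\phi_1$; (b) $\mathrm{EXH}(\phi_1)\subseteq\mathrm{EXH}(\phi_2)$; (c) $\mathrm{FIN}(\phi_1)\subseteq\mathrm{FIN}(\phi_2)$; (d) $\mathrm{EXH}(\phi_1)\subseteq\mathrm{FIN}(\phi_2)$.
   Context: $\mathbb{N}=\{1,2,3,\ldots\}$. A submeasure is a function $\phi:\mathcal{P}(\mathbb{N})\to[0,\infty]$ with $\phi(\emptyset)=0$, $\phi(\{n\})<\infty$ for all $n\in\mathbb{N}$, and $\phi(C)\le\phi(C\cup D)\le\phi(C)+\phi(D)$ for all $C,D\subseteq\mathbb{N}$. It is lower semicontinuous (lsc) if $\phi(C)=\lim_{n\to\infty}\phi(C\cap\{1,\ldots,n\})$ for all $C\subseteq\mathbb{N}$. For an lsc submeasure $\phi$ let $\mathcal{M}_\phi$ be the family of all measures $\mu$ on $\mathbb{N}$ (defined on $\mathcal{P}(\mathbb{N})$) with $\mu\le\phi$; $\phi$ is non-pathological if $\phi(C)=\sup\{\mu(C):\mu\in\mathcal{M}_\phi\}$ for all $C\subseteq\mathbb{N}$. For a non-pathological lsc submeasure $\phi$ and $x=(x_n)\in\mathbb{R}^{\mathbb{N}}$ put $\hat\phi(x)=\sup\{\sum_{n\in\mathbb{N}}\mu(\{n\})|x_n|:\mu\in\mathcal{M}_\phi\}\in[0,\infty]$.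 For a finite sequence $x$, $\hat\phi(x)$ means $\hat\phi$ of $x$ extended by zeros. Define $\mathrm{FIN}(\phi)=\{x\in\mathbb{R}^{\mathbb{N}}:\hat\phi(x)<\infty\}$ and $\mathrm{EXH}(\phi)=\{x\in\mathbb{R}^{\mathbb{N}}:\lim_{n\to\infty}\hat\phi(x\cdot\chi_{\{n,n+1,\ldots\}})=0\}$, where $\chi_C$ is the characteristic function of $C$ and the product is pointwise. $\phi_2\preceq\phi_1$ means: there is $M>0$ such that $\hat\phi_2(x)\le M\hat\phi_1(x)$ for every finite real sequence $x\in\bigcup_{n\in\mathbb{N}}\mathbb{R}^n$. *)

(* Defs.v *)
From HB Require Import structures.
From mathcomp Require Import all_boot all_order all_algebra.
From mathcomp Require Import all_classical all_reals all_analysis.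

Set Implicit Arguments.
Unset Strict Implicit.
Unset Printing Implicit Defensive.

Import Order.TTheory GRing.Theory Num.Theory.
Import numFieldNormedType.Exports.

Local Open Scope classical_set_scope.
Local Open Scope ring_scope.
Local Open Scope ereal_scope.

(* The index set {1, 2, 3, ...} is represented by [nat], k standing for k + 1;
   thus {1, ..., n} becomes [`I_n] = [set k | (k < n)%N]. *)

Record submeasure (R : realType) (phi : set nat -> \bar R) : Prop := {
  submeasure_ge0 : forall C, 0 <= phi C;
  submeasure_set0 : phi set0 = 0;
  submeasure_set1_lty : forall n, phi [set n] < +oo;
  submeasure_mono : forall C D, phi C <= phi (C `|` D);
  submeasure_subadd : forall C D, phi (C `|` D) <= phi C + phi D }.

Definition lsc (R : realType) (phi : set nat -> \bar R) : Prop :=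
  forall C, phi (C `&` `I_n) @[n --> \oo] --> phi C.

(* Every subset of [nat] is measurable for the canonical sigma-algebra, so
   these are measures defined on the whole power set. *)
Definition dominated_measures (R : realType) (phi : set nat -> \bar R) :
    set {measure set nat -> \bar R} :=
  [set mu | forall C, mu C <= phi C].

Definition non_pathological (R : realType) (phi : set nat -> \bar R) : Prop :=
  forall C, phi C = ereal_sup [set mu C | mu in dominated_measures phi].

Definition hat (R : realType) (phi : set nat -> \bar R) (x : nat -> R) : \bar R :=
  ereal_sup [set \sum_(0 <= n <oo) (mu [set n] * `|x n|%:E)
            | mu in dominated_measures phi].

Definition FIN (R : realType) (phi : set nat -> \bar R) : set (nat -> R) :=
  [set x | hat phi x < +oo].

Definition EXH (R : realType) (phi : set nat -> \bar R) : set (nat -> R) :=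
  [set x | hat phi (x \* \1_[set k | (n <= k)%N])%R @[n --> \oo] --> 0].

Definition extend0 (R : realType) (n : nat) (x : n.-tuple R) : nat -> R :=
  fun k => nth 0%R x k.

(* Argument order as in "phi2 precedes phi1": the dominated submeasure is first. *)
Definition preceq (R : realType) (phi2 phi1 : set nat -> \bar R) : Prop :=
  exists2 M : R, (0 < M)%R &
    forall (n : nat) (x : n.-tuple R), (0 < n)%N ->
      hat phi2 (extend0 x) <= M%:E * hat phi1 (extend0 x).

(* Main.v *)
Require Import Defs.
From mathcomp Require Import all_boot all_order all_algebra.
From mathcomp Require Import all_classical all_reals all_analysis.
From mathcomp Require Import ring.

Import Order.TTheory GRing.Theory Num.Theory.
Import numFieldNormedType.Exports.

(** The essential implication goes from [EXH phi1 `<=` FIN phi2] to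
    [preceq phi2 phi1], by a gliding-hump argument with summation in place of
    disjoint humps.  If [preceq] fails, then after rescaling there are finitely
    supported sequences [y k] with [hat phi1 (y k) = 1 / 2 ^ k.+1] and
    [hat phi2 (y k) > k.+1] ([not_preceq_witness]).  Since [phi1] charges every
    point, the series of the [`|y k|] converges pointwise to a real sequence
    [x].  On the one hand [x] dominates each [y k], so that [hat phi2 x] is
    infinite.  On the other hand [hat phi1] is countably subadditive
    ([hat_sigma_subadd]); a tail of [x] starting beyond the supports of
    [y 0], ..., [y K.-1] therefore costs at most the sum of [hat phi1 (y k)] over
    [K <= k], which is small, and [x] is in [EXH phi1] ([series_EXH]).

    The other steps are soft.  As [hat phi] is the supremum of its values on the
    truncations of a sequence, an inequality between the two hats on finite
    sequences extends to all sequences ([preceq_hat]); hence [preceq] passes to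
    both [EXH] and [FIN].  Always [EXH phi `<=` FIN phi], because a finite
    segment of a sequence has finite hat.  Inclusion of the [EXH] spaces implies
    inclusion of the [FIN] spaces by going through [EXH phi1 `<=` FIN phi2] and
    [preceq]. *)

Local Open Scope classical_set_scope.
Local Open Scope ring_scope.
Local Open Scope ereal_scope.

(** * Sequences of extended reals *)

Lemma ge0_cvge0P {R : realType} {f : nat -> \bar R} : (forall n, 0 <= f n) ->
  f n @[n --> \oo] --> 0 <->
  forall e : R, (0 < e)%R -> \forall n \near \oo, f n <= e%:E.
Proof.
move=> f0; split => [/fine_cvgP[ffin /cvgr0Pnorm_le fcvg] e e0|fle].
  near=> n; have ffinn : f n \is a fin_num by near: n.
  rewrite -(fineK ffinn) lee_fin (le_trans (ler_norm _))//; near: n; exact: fcvg.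
apply/fine_cvgP; split.
  near=> n; rewrite ge0_fin_numE//; apply: (@le_lt_trans _ _ 1%:E).
    by near: n; exact: fle.
  exact: ltry.
apply/cvgr0Pnorm_le => e e0; near=> n.
have fn : f n <= e%:E by near: n; exact: fle.
have ffin : f n \is a fin_num by rewrite ge0_fin_numE// (le_lt_trans fn)// ltry.
by rewrite /= ger0_norm ?fine_ge0// -lee_fin fineK.
Unshelve. all: by end_near. Qed.

(** * The extended seminorm [hat phi] *)

Section hat_theory.
Context {R : realType} {phi : set nat -> \bar R}.
Implicit Types (x : nat -> R) (y : nat -> nat -> R).

Lemma hat_ubound (mu : {measure set nat -> \bar R}) x :
  dominated_measures phi mu ->
  \sum_(0 <= n <oo) (mu [set n] * `|x n|%:E) <= hat phi x.
Proof. by move=> mudom; apply: ereal_sup_ubound; exists mu. Qed.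

Lemma ge_hat x (a : \bar R) :
  (forall mu : {measure set nat -> \bar R}, dominated_measures phi mu ->
    \sum_(0 <= n <oo) (mu [set n] * `|x n|%:E) <= a) ->
  hat phi x <= a.
Proof. by move=> le_a; apply: ge_ereal_sup => _ [mu mudom <-]; exact: le_a. Qed.

(** The zero measure is always dominated, so the supremum is over a nonempty
    family. *)
Lemma hat_ge0 (sub : submeasure phi) x : 0 <= hat phi x.
Proof.
have mudom : dominated_measures phi mzero by move=> C; exact: submeasure_ge0.
apply: le_trans (hat_ubound _ x mudom).
by apply: nneseries_ge0 => n _ _; rewrite mule_ge0.
Qed.

Lemma le_hat x x' : (forall i, `|x i| <= `|x' i|)%R -> hat phi x <= hat phi x'.
Proof.
move=> lexx'; apply: ge_hat => mu mudom; apply: le_trans (hat_ubound _ _ mudom).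
apply: lee_nneseries => [i _ _|i _]; first by rewrite mule_ge0.
by rewrite lee_wpmul2l// lee_fin.
Qed.

Lemma hatZ (c : R) x : (0 < c)%R ->
  hat phi (fun i => c * x i)%R = c%:E * hat phi x.
Proof.
move=> c0; rewrite /hat -ereal_sup_pZl//; congr ereal_sup.
rewrite image_comp; apply: eq_imagel => mu _ /=.
rewrite -nneseriesZl; last by move=> i _ /=; rewrite mule_ge0.
by apply: eq_eseriesr => i _; rewrite normrM gtr0_norm// EFinM muleCA.
Qed.

(** The left-hand side is [hat phi] of the restriction of [x] to [{i}]: this is
    where non-pathology turns the value of [phi] at a point into a supremum of
    masses. *)
Lemma coord_le_hat (sub : submeasure phi) (np : non_pathological phi) x i :
  phi [set i] * `|x i|%:E <= hat phi x.
Proof.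
have hmu (mu : {measure set nat -> \bar R}) : dominated_measures phi mu ->
    mu [set i] * `|x i|%:E <= hat phi x.
  move=> mudom; apply: le_trans (hat_ubound _ _ mudom).
  apply: le_trans (nneseries_lim_ge i.+1 _); last first.
    by move=> n _ _; rewrite mule_ge0.
  rewrite big_nat_recr//= leeDr// sume_ge0// => n _.
have [x0|xn0] := eqVneq `|x i|%R 0%R.
  by rewrite x0 mule0 hat_ge0.
have x_gt0 : (0 < `|x i|)%R by rewrite lt_neqAle eq_sym xn0/=.
rewrite -lee_pdivlMr// np; apply: ge_ereal_sup => _ [mu mudom <-].
by rewrite lee_pdivlMr// hmu.
Qed.

Lemma normr_tail x n i :
  `|(x \* \1_[set k | (n <= k)%N])%R i|%R = (if (n <= i)%N then `|x i| else 0)%R.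
Proof.
rewrite /= indicE; case: (leqP n i) => ni; first by rewrite mem_set// mulr1.
by rewrite memNset ?mulr0 ?normr0//= leqNgt ni.
Qed.

(** A dominated measure has mass at most [phi [set i]] at [i], whence a bound on
    the initial segment that does not depend on the measure. *)
Lemma hat_le_split (sub : submeasure phi) x n :
  hat phi x <= \sum_(0 <= i < n) (phi [set i] * `|x i|%:E) +
               hat phi (x \* \1_[set k | (n <= k)%N])%R.
Proof.
apply: ge_hat => mu mudom.
rewrite (nneseries_split 0 n); last by move=> k _; rewrite mule_ge0.
rewrite add0n; apply: leeD.
  by apply: lee_sum => i _; rewrite lee_wpmul2r// mudom.
apply: le_trans (hat_ubound _ _ mudom).
rewrite [leRHS](nneseries_split 0 n); last by move=> k _; rewrite mule_ge0.
rewrite add0n -[leLHS]add0e leeD//.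
  by apply: sume_ge0 => i _; rewrite mule_ge0.
rewrite -[leLHS]nneseries_addn; last by move=> i; rewrite mule_ge0.
rewrite -[leRHS]nneseries_addn; last by move=> i; rewrite mule_ge0.
apply: lee_nneseries => [i _ _|i _]; first by rewrite mule_ge0.
by rewrite normr_tail leq_addl.
Qed.

(** For a single measure this is the exchange of two sums of nonnegative
    terms. *)
Lemma hat_sigma_subadd (sub : submeasure phi) x y :
  (forall n, `|x n|%:E <= \sum_(0 <= k <oo) `|y k n|%:E) ->
  hat phi x <= \sum_(0 <= k <oo) hat phi (y k).
Proof.
move=> lexy; apply: ge_hat => mu mudom.
apply: (@le_trans _ _ (\sum_(0 <= k <oo)
    \sum_(0 <= n <oo) (mu [set n] * `|y k n|%:E))); last first.
  apply: lee_nneseries => [k _ _|k _]; last exact: hat_ubound.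
  by apply: nneseries_ge0 => n _ _; rewrite mule_ge0.
rewrite nneseries_interchange; last by move=> k n; rewrite mule_ge0.
apply: lee_nneseries => [n _ _|n _]; first by rewrite mule_ge0.
have mufin : mu [set n] \is a fin_num.
  rewrite ge0_fin_numE//; apply: le_lt_trans (submeasure_set1_lty sub n).
  exact: mudom.
by rewrite -(fineK mufin) nneseriesZl// lee_wpmul2l// lee_fin fine_ge0.
Qed.

(** Two suprema, over measures and over partial sums, commute. *)
Lemma hat_le_trunc x (a : \bar R) :
  (forall n, (0 < n)%N -> hat phi (x \* \1_`I_n)%R <= a) -> hat phi x <= a.
Proof.
move=> le_a; apply: ge_hat => mu mudom; apply: lime_le.
  by apply: is_cvg_nneseries => n _ _; rewrite mule_ge0.
near=> n; apply: le_trans (le_a n _); last by near: n; exists 1%N.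
apply: le_trans (hat_ubound _ _ mudom).
apply: le_trans (nneseries_lim_ge n _); last by move=> k _ _; rewrite mule_ge0.
rewrite big_nat_cond [leRHS]big_nat_cond lee_sum// => i /andP[/= ilen _].
by rewrite indicE mem_set//= mulr1.
Unshelve. all: by end_near. Qed.

Lemma hat_lty_tail (sub : submeasure phi) x n :
  hat phi (x \* \1_[set k | (n <= k)%N])%R < +oo -> hat phi x < +oo.
Proof.
move=> tail_fin; apply: (le_lt_trans (hat_le_split sub x n)).
rewrite lte_add_pinfty//; apply: lte_sum_pinfty => i _.
by rewrite lte_mul_pinfty ?ltry// ?ge0_fin_numE ?submeasure_ge0//;
  exact: submeasure_set1_lty.
Qed.

Lemma hat_le0 {x} : (forall i, x i = 0%R) -> hat phi x <= 0.
Proof.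
move=> x0; apply: ge_hat => mu _.
by rewrite eseries0// => i _ _; rewrite x0 normr0 mule0.
Qed.

Lemma hat0 (sub : submeasure phi) x : (forall i, x i = 0%R) -> hat phi x = 0.
Proof. by move=> x0; apply/eqP; rewrite eq_le hat_ge0// andbT hat_le0. Qed.

Lemma tail_eq0 x n m : (forall i, (n <= i)%N -> x i = 0%R) -> (n <= m)%N ->
  forall i, (x \* \1_[set k | (m <= k)%N])%R i = 0%R.
Proof.
move=> x0 nm i; apply/eqP; rewrite -normr_eq0 normr_tail; case: ifP => // mi.
by rewrite x0 ?normr0// (leq_trans nm).
Qed.

Lemma hat_fin_supp (sub : submeasure phi) x n :
  (forall i, (n <= i)%N -> x i = 0%R) -> hat phi x < +oo.
Proof.
move=> x0; apply: (hat_lty_tail sub x n).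
by rewrite hat0//; exact: tail_eq0 x0 _.
Qed.

Lemma EXH_sub_FIN (sub : submeasure phi) : EXH phi `<=` FIN phi.
Proof.
move=> x /(ge0_cvge0P (fun n => hat_ge0 sub _))/(_ _ ltr01)[n _ /(_ n)].
move=> /(_ (leqnn n)) tail_le1; apply: (hat_lty_tail sub x n).
by rewrite (le_lt_trans tail_le1)// ltry.
Qed.

(** The finitely many sequences [y k] with [k < K] vanish on a late enough tail,
    so such a tail of [x] is controlled by the remainder of index [K] of the
    convergent series of the [hat phi (y k)]. *)
Lemma series_EXH (sub : submeasure phi) x y :
  (forall k, exists n, forall i, (n <= i)%N -> y k i = 0%R) ->
  \sum_(0 <= k <oo) hat phi (y k) < +oo ->
  (forall n, `|x n|%:E <= \sum_(0 <= k <oo) `|y k n|%:E) ->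
  EXH phi x.
Proof.
move=> ysupp ysum lexy.
pose tl m (z : nat -> R) := (z \* \1_[set k | (m <= k)%N])%R.
have tail0 := nneseries_tail_cvg ysum (fun k _ => hat_ge0 sub (y k)).
have tail_le K : \forall n \near \oo,
    hat phi (tl n x) <= \sum_(K <= k <oo) hat phi (y k).
  have [N hN] : exists N, forall k i, (k < K)%N -> (N <= i)%N -> y k i = 0%R.
    elim: K => [|K [N hN]]; first by exists 0%N.
    have [N' hN'] := ysupp K; exists (maxn N N') => k i.
    rewrite ltnS leq_eqVlt geq_max => /orP[/eqP-> /andP[_]|kK /andP[+ _]].
      exact: hN'.
    exact: hN.
  exists N => // n /= Nn.
  apply: (@le_trans _ _ (\sum_(0 <= k <oo) hat phi (tl n (y k)))).
    apply: hat_sigma_subadd => // i; rewrite normr_tail.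
    case: ifPn => ni; last by rewrite nneseries_ge0.
    apply: le_trans (lexy i) _; apply: lee_nneseries => // k _.
    by rewrite normr_tail ni.
  rewrite (nneseries_split 0 K); last by move=> k _; exact: hat_ge0.
  rewrite add0n big_nat_cond big1 ?add0e; last first.
    move=> k /andP[/= kK _]; apply: hat0 => //; apply: tail_eq0 Nn => i.
    exact: hN.
  apply: lee_nneseries => [k _ _|k _]; first exact: hat_ge0.
  by apply: le_hat => i; rewrite normr_tail; case: ifP.
apply/ge0_cvge0P => [n|e e0]; first exact: hat_ge0.
have /ge0_cvge0P/(_ e e0)[|K _ /(_ K (leqnn K)) tailK] := tail0.
  by move=> n; apply: nneseries_ge0 => k _ _; exact: hat_ge0.
by near do apply: (le_trans _ tailK); exact: tail_le.
Unshelve. all: by end_near. Qed.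

End hat_theory.

(** * Comparison of two submeasures *)

Lemma preceq_hat {R : realType} (phi1 phi2 : set nat -> \bar R) :
  preceq phi2 phi1 ->
  exists2 M : R, (0 < M)%R & forall x, hat phi2 x <= M%:E * hat phi1 x.
Proof.
move=> [M M0 leM]; exists M => // x; apply: hat_le_trunc => n n0.
have trunc i : extend0 [tuple x j | j < n] i = (x \* \1_`I_n)%R i.
  rewrite /extend0/= indicE; case: (ltnP i n) => ni.
    rewrite mem_set//= mulr1 -[i]/(nat_of_ord (Ordinal ni)).
    by rewrite nth_mktuple.
  by rewrite nth_default ?size_tuple ?card_ord// memNset ?mulr0//= ltnNge ni.
rewrite -(funext trunc); apply: le_trans (leM _ _ n0) _.
rewrite lee_wpmul2l ?lee_fin ?(ltW M0)//; apply: le_hat => i.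
rewrite trunc/= indicE normrM ler_piMr//.
by case: (_ \in _); rewrite ?normr1 ?normr0.
Qed.

Lemma preceq_EXH {R : realType} (phi1 phi2 : set nat -> \bar R)
    (sub1 : submeasure phi1) (sub2 : submeasure phi2) :
  preceq phi2 phi1 -> EXH phi1 `<=` EXH phi2.
Proof.
move=> /preceq_hat[M M0 leM] x.
move=> /(ge0_cvge0P (fun n => hat_ge0 sub1 _)) xE.
apply/ge0_cvge0P => [n|e e0]; first exact: hat_ge0.
near=> n; apply: le_trans (leM _) _.
rewrite muleC -lee_pdivlMr// -EFinM.
by near: n; apply: xE; rewrite divr_gt0.
Unshelve. all: by end_near. Qed.

Lemma preceq_FIN {R : realType} (phi1 phi2 : set nat -> \bar R)
    (sub1 : submeasure phi1) :
  preceq phi2 phi1 -> FIN phi1 `<=` FIN phi2.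
Proof.
move=> /preceq_hat[M M0 leM] x xF; apply: le_lt_trans (leM x) _.
by rewrite lte_mul_pinfty// lee_fin ltW.
Qed.

(** As both hats are homogeneous, a finite sequence violating the inequality with
    constant [M / e] can be rescaled to have [hat phi1] equal to [e]; positivity
    of [phi1] on points ensures that [hat phi1] does not vanish on it. *)
Lemma not_preceq_witness {R : realType} (phi1 phi2 : set nat -> \bar R)
    (sub1 : submeasure phi1) (np1 : non_pathological phi1)
    (pos1 : forall i, 0 < phi1 [set i]) (e M : R) :
  (0 < e)%R -> (0 < M)%R -> ~ preceq phi2 phi1 ->
  exists y : nat -> R, [/\ exists n, forall i, (n <= i)%N -> y i = 0%R,
    hat phi1 y = e%:E & M%:E < hat phi2 y].
Proof.
move=> e0 M0 npre.
have [n [x x_gt]] : exists n (x : n.-tuple R),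
    (M / e)%:E * hat phi1 (extend0 x) < hat phi2 (extend0 x).
  apply: contrapT => nex; apply: npre; exists (M / e)%R; first exact: divr_gt0.
  move=> n x _; rewrite leNgt; apply/negP => x_gt; apply: nex.
  by exists n, x.
have x0 i : (n <= i)%N -> extend0 x i = 0%R.
  by move=> ni; rewrite /extend0 nth_default// size_tuple.
move: (extend0 x) x_gt x0 => {}x x_gt x0.
have hx_fin : hat phi1 x \is a fin_num.
  by rewrite ge0_fin_numE ?hat_ge0//; exact: hat_fin_supp x0.
have hx_gt0 : 0 < hat phi1 x.
  rewrite lt_neqAle hat_ge0// andbT; apply/negP => /eqP hx0.
  have xz i : x i = 0%R.
    apply/eqP; apply: contraTT (coord_le_hat sub1 np1 x i) => xi.
    by rewrite -hx0 -ltNge mule_gt0// lte_fin normr_gt0.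
  move: x_gt; rewrite -hx0 mule0 => /lt_le_trans.
  by move=> /(_ _ (hat_le0 xz)); rewrite ltxx.
set h := fine (hat phi1 x).
have hE : hat phi1 x = h%:E by rewrite fineK.
have h0 : (0 < h)%R by rewrite -lte_fin -hE.
exists (fun i => e / h * x i)%R; split.
- by exists n => i ni; rewrite x0// mulr0.
- by rewrite hatZ ?divr_gt0// hE -EFinM divfK ?gt_eqF.
- rewrite hatZ ?divr_gt0//; move: x_gt; rewrite hE -EFinM.
  rewrite -(@lte_pmul2l _ (e / h)%:E)// ?lte_fin ?divr_gt0//.
  by rewrite -EFinM mulrACA -mulrA; congr (_ < _); congr EFin; field;
    rewrite !gt_eqF.
Qed.

Lemma EXH_sub_FIN_preceq {R : realType} (phi1 phi2 : set nat -> \bar R)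
    (sub1 : submeasure phi1) (sub2 : submeasure phi2)
    (np1 : non_pathological phi1) (pos1 : forall i, 0 < phi1 [set i]) :
  EXH phi1 `<=` FIN phi2 -> preceq phi2 phi1.
Proof.
move=> EF; apply: contrapT => npre.
have /choice[y yP] : forall k : nat, exists y : nat -> R,
    [/\ exists n, forall i, (n <= i)%N -> y i = 0%R,
      hat phi1 y = (1 / (2 ^ k.+1)%:R)%:E & k.+1%:R%:E < hat phi2 y].
  by move=> k; exact: not_preceq_witness.
have ysum : \sum_(0 <= k <oo) hat phi1 (y k) < +oo.
  rewrite (eq_eseriesr (g := fun k => (1 / (2 ^ k.+1)%:R)%:E)); last first.
    by move=> k _; have [] := yP k.
  by rewrite (le_lt_trans (epsilon_trick0 _ _))// ltry.
(* Weighted by the positive number [phi1 [set i]], the series at [i] is bounded by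
   that of the [hat phi1 (y k)]. *)
have sy_fin i : \sum_(0 <= k <oo) `|y k i|%:E \is a fin_num.
  have si_ge0 : 0 <= \sum_(0 <= k <oo) `|y k i|%:E by apply: nneseries_ge0.
  have phi_fin : phi1 [set i] \is a fin_num.
    by rewrite ge0_fin_numE ?ltW//; exact: submeasure_set1_lty.
  rewrite ge0_fin_numE// ltey; apply/negP => /eqP sy.
  have := ysum; rewrite ltNge => /negP; apply.
  apply: (@le_trans _ _ (\sum_(0 <= k <oo) phi1 [set i] * `|y k i|%:E)).
    by rewrite -(fineK phi_fin) nneseriesZl// sy fineK// gt0_muley.
  apply: lee_nneseries => [k _ _|k _]; last exact: coord_le_hat.
  by rewrite mule_ge0// ltW.
pose x i := fine (\sum_(0 <= k <oo) `|y k i|%:E).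
have xE i : `|x i|%:E = \sum_(0 <= k <oo) `|y k i|%:E.
  by rewrite ger0_norm ?fineK// fine_ge0// nneseries_ge0.
have /EF : EXH phi1 x.
  apply: (series_EXH sub1 _ y) => //; first by move=> k; have [] := yP k.
  by move=> n; rewrite xE.
rewrite /FIN/= => xF.
have hfin : hat phi2 x \is a fin_num by rewrite ge0_fin_numE// hat_ge0.
have y_le k : hat phi2 (y k) <= hat phi2 x.
  apply: le_hat => i; rewrite -lee_fin xE.
  apply: le_trans (nneseries_lim_ge k.+1 _) => //.
  by rewrite big_nat_recr//= leeDr// sume_ge0.
(* With [k] the integer part of [hat phi2 x], the hump [y k] exceeds it. *)
have [_ _ big] := yP (Num.truncn (fine (hat phi2 x))).
have := lt_le_trans big (y_le _); rewrite -(fineK hfin) lte_fin.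
by rewrite ltNge ltW// truncnS_gt.
Qed.

Theorem theorem4p5 (R : realType) (phi1 phi2 : set nat -> \bar R)
    (sub1 : submeasure phi1) (sub2 : submeasure phi2)
    (lsc1 : lsc phi1) (lsc2 : lsc phi2)
    (np1 : non_pathological phi1) (np2 : non_pathological phi2)
    (pos1 : forall i, 0 < phi1 [set i]) (pos2 : forall i, 0 < phi2 [set i]) :
  [<-> preceq phi2 phi1;
       EXH phi1 `<=` EXH phi2;
       FIN phi1 `<=` FIN phi2;
       EXH phi1 `<=` FIN phi2].
Proof.
tfae.
- exact: preceq_EXH.
- move=> EE; apply: preceq_FIN => //; apply: EXH_sub_FIN_preceq => //.
  exact: subset_trans EE (EXH_sub_FIN sub2).
- by move=> FF; apply: subset_trans FF; exact: EXH_sub_FIN.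
- exact: EXH_sub_FIN_preceq.
Qed.
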